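(* Let $d\ge1$, $n\ge1$, and let $\{\boldsymbol{x}_i\}_{i=1}^n$ be an $n$-point jittered sampling point process on $\mathbb{S}^d$ associated with a partition $\{D_{i,n}\}_{i=1}^n$ and constant $c$ as described in the context. Then \[ \frac{n^2}{d+1}\le\mathbb{E}\big(\mathrm{FP}(\{\boldsymbol{x}_i\}_{i=1}^n)\big)\le\frac{n^2}{d+1}+n-n\left(1-\frac{c^2}{2n^{2/d}}\right)^2. \]
   Context: $\mathbb{S}^d=\{\boldsymbol{x}\in\mathbb{R}^{d+1}:\|\boldsymbol{x}\|=1\}$, $\sigma_d$ the normalized surface measure, $\mathrm{diam}\,A=\sup\{\|\boldsymbol{x}-\boldsymbol{y}\|:\boldsymbol{x},\boldsymbol{y}\in A\}$. Frame potential: $\mathrm{FP}(\{\boldsymbol{x}_i\}_{i=1}^n)=\sum_{i,j=1}^n|\langle\boldsymbol{x}_i,\boldsymbol{x}_j\rangle|^2$. Jittered sampling point process: let $\{D_{i,n}\}_{i=1}^n$ be an equal-area partition of $\mathbb{S}^d$: $\bigcup_{j=1}^nD_{j,n}=\mathbb{S}^d$, $\sigma_d(D_{j,n}\cap D_{k,n})=0$ for $j\ne k$, $\sigma_d(D_{j,n})=1/n$, and $\mathrm{diam}\,D_{j,n}\le c/n^{1/d}<\sqrt2$ for all $j$, where $c$ is a constant independent of $n$. Independently for each $i$, let $\boldsymbol{x}_i$ be a point chosen uniformly at random (w.r.t. normalized $\sigma_d$ restricted to $D_{i,n}$) from $D_{i,n}$. *)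

(* Defs.v *)
From HB Require Import structures.
From mathcomp Require Import all_boot all_order all_algebra.
From mathcomp Require Import all_classical all_reals all_analysis.
From mathcomp Require Import matrix_normedtype.
Set Implicit Arguments. Unset Strict Implicit. Unset Printing Implicit Defensive.
Import Order.TTheory GRing.Theory Num.Theory.
Import numFieldNormedType.Exports.
Local Open Scope classical_set_scope.
Local Open Scope ring_scope.

(* Points of R^{d+1} are row vectors 'rV[R]_(d.+1), equipped with the Borel
   sigma-algebra (generated by the open sets of the product topology, which is
   the Euclidean topology). *)
Definition Rvec (R : realType) (d : nat) :=
  g_sigma_algebraType (@open 'rV[R]_(d.+1)).

Definition dotv (R : realType) (d : nat) (x y : 'rV[R]_(d.+1)) : R :=
  \sum_(k < d.+1) x ord0 k * y ord0 k.
Definition enorm (R : realType) (d : nat) (x : 'rV[R]_(d.+1)) : R :=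
  Num.sqrt (dotv x x).

Definition sphere (R : realType) (d : nat) : set (Rvec R d) :=
  [set x | enorm (x : 'rV[R]_(d.+1)) = 1].

Definition orthogonal_mx (R : realType) (d : nat) (Q : 'M[R]_(d.+1)) : Prop :=
  Q *m Q^T = 1%:M.

(* sigma is the normalized surface measure sigma_d on S^d, viewed as a Borel
   measure on R^{d+1}: a probability measure carried by S^d and invariant under
   all orthogonal maps (this property characterizes sigma_d uniquely). *)
Definition normalized_surface_measure (R : realType) (d : nat)
  (sigma : {measure set (Rvec R d) -> \bar R}) : Prop :=
  [/\ sigma setT = 1%E,
      sigma (~` @sphere R d) = 0%E &
      forall Q : 'M[R]_(d.+1), orthogonal_mx Q ->
        forall A : set (Rvec R d), measurable A ->
          sigma ((fun x : Rvec R d => (x : 'rV[R]_(d.+1)) *m Q) @^-1` A)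
          = sigma A].

Definition diam_le (R : realType) (d : nat) (A : set (Rvec R d)) (r : R) : Prop :=
  forall x y, A x -> A y -> enorm ((x : 'rV[R]_(d.+1)) - y) <= r.

Definition equal_area_partition (R : realType) (d n : nat)
  (sigma : {measure set (Rvec R d) -> \bar R}) (c : R)
  (D : 'I_n -> set (Rvec R d)) : Prop :=
  [/\ (forall i, measurable (D i)),
      \bigcup_(i in [set: 'I_n]) D i = @sphere R d,
      (forall j k, j != k -> sigma (D j `&` D k) = 0%E),
      (forall j, sigma (D j) = (n%:R^-1)%:E) &
      (forall j, diam_le (D j) (c / (n%:R `^ (d%:R^-1))))
      /\ c / (n%:R `^ (d%:R^-1)) < Num.sqrt 2].

Definition mutually_independent (R : realType) (dO : measure_display)
  (Omega : measurableType dO) (P : probability Omega R) (d n : nat)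
  (X : 'I_n -> Omega -> Rvec R d) : Prop :=
  forall A : 'I_n -> set (Rvec R d), (forall i, measurable (A i)) ->
    P (\bigcap_(i in [set: 'I_n]) (X i @^-1` A i))
    = (\prod_(i < n) P (X i @^-1` A i))%E.

(* Jittered sampling: independent x_i, each uniform (w.r.t. sigma restricted
   to D_i, normalized) on D_i. Since sigma(D_i) = 1/n, the law of x_i is
   A |-> sigma(A ∩ D_i) / sigma(D_i) = n * sigma(A ∩ D_i). *)
Definition jittered_sampling (R : realType) (dO : measure_display)
  (Omega : measurableType dO) (P : probability Omega R) (d n : nat)
  (sigma : {measure set (Rvec R d) -> \bar R})
  (D : 'I_n -> set (Rvec R d)) (X : 'I_n -> Omega -> Rvec R d) : Prop :=
  [/\ (forall i, measurable_fun setT (X i)),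
      mutually_independent P X &
      forall i (A : set (Rvec R d)), measurable A ->
        P (X i @^-1` A) = (n%:R%:E * sigma (A `&` D i))%E].

Definition frame_potential (R : realType) (d n : nat)
  (x : 'I_n -> 'rV[R]_(d.+1)) : R :=
  \sum_(i < n) \sum_(j < n) `|dotv (x i) (x j)| ^+ 2.

(* Main.v *)
(* Let M_i = E[x_i x_i^T]. For i <> j independence gives
   E <x_i, x_j>^2 = <M_i, M_j> (Frobenius product), while the diagonal terms of
   the frame potential are 1. The average of the laws of the x_i is sigma, and
   the symmetries of sigma force its second-moment matrix to be I / (d + 1), so
   that sum_i M_i = n I / (d + 1) and
     E FP = n^2 / (d + 1) + n - sum_i |M_i|^2.
   Finally |M_i|^2 is the mean of <x, y>^2 over independent x, y in D_i; there
   |x - y| <= r := c / n^(1/d) < sqrt 2 yields 0 <= 1 - r^2 / 2 <= <x, y> <= 1. *)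
Require Import Defs.
From HB Require Import structures.
From mathcomp Require Import all_boot all_order all_algebra.
From mathcomp Require Import all_classical all_reals all_analysis.
From mathcomp Require Import matrix_normedtype.
From mathcomp Require Import measurable_realfun.
From mathcomp Require Import perm ring lra.
Set Implicit Arguments. Unset Strict Implicit. Unset Printing Implicit Defensive.
Import Order.TTheory GRing.Theory Num.Theory.
Import numFieldNormedType.Exports.
Local Open Scope classical_set_scope.
Local Open Scope ring_scope.

(** * Bounded measurable functions and their integrals *)

(** A class stable under sums, products and composition with measurable maps, and integrable for
    every measure of total mass 1: integrability side conditions reduce to membership in it. *)
Definition bounded_measurable {dT : measure_display} {T : measurableType dT}
    {R : realType} (f : T -> R) : Prop :=
  measurable_fun setT f /\ exists M, forall x, `|f x| <= M.

Lemma bounded_measurable_cst (dT : measure_display) (T : measurableType dT)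
    (R : realType) (a : R) : bounded_measurable (fun _ : T => a).
Proof. by split; [exact: measurable_cst|exists `|a|]. Qed.

Lemma bounded_measurableD (dT : measure_display) (T : measurableType dT)
    (R : realType) (f g : T -> R) :
  bounded_measurable f -> bounded_measurable g ->
  bounded_measurable (fun x => f x + g x).
Proof.
move=> [mf [M fM]] [mg [N gN]]; split; first exact: measurable_funD.
by exists (M + N) => x; rewrite (le_trans (ler_normD _ _))// lerD.
Qed.

Lemma bounded_measurableM (dT : measure_display) (T : measurableType dT)
    (R : realType) (f g : T -> R) :
  bounded_measurable f -> bounded_measurable g ->
  bounded_measurable (fun x => f x * g x).
Proof.
move=> [mf [M fM]] [mg [N gN]]; split; first exact: measurable_funM.
by exists (M * N) => x; rewrite normrM ler_pM.
Qed.

Lemma bounded_measurable_sum (dT : measure_display) (T : measurableType dT)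
    (R : realType) (I : Type) (s : seq I) (f : I -> T -> R) :
  (forall i, bounded_measurable (f i)) ->
  bounded_measurable (fun x => \sum_(i <- s) f i x).
Proof.
move=> bf; elim: s => [|i s IHs].
  by under eq_fun do rewrite big_nil; exact: bounded_measurable_cst.
by under eq_fun do rewrite big_cons; exact: bounded_measurableD.
Qed.

Lemma bounded_measurable_comp (d1 d2 : measure_display)
    (T1 : measurableType d1) (T2 : measurableType d2) (R : realType)
    (f : T2 -> R) (h : T1 -> T2) :
  bounded_measurable f -> measurable_fun setT h ->
  bounded_measurable (fun x => f (h x)).
Proof.
move=> [mf [M fM]] mh; split; first exact: measurableT_comp.
by exists M => x; exact: fM.
Qed.

Section bounded_integrals.
Context {dT : measure_display} {T : measurableType dT} {R : realType}.
Variable mu : {measure set T -> \bar R}.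
Hypothesis mu1 : mu setT = 1%E.

Lemma bounded_measurable_integrable (f : T -> R) :
  bounded_measurable f -> mu.-integrable setT (EFin \o f).
Proof.
move=> [mf [M fM]]; apply: measurable_bounded_integrable => //.
  by rewrite mu1 ltry.
by exists M; split; [exact: num_real|move=> N MN x _ /=; apply: le_trans (ltW MN)].
Qed.

Lemma EFin_Rintegral (f : T -> R) : bounded_measurable f ->
  (\int[mu]_x (f x)%:E)%E = (\int[mu]_x f x)%:E.
Proof.
move=> bf; rewrite /Rintegral fineK//; apply: integrable_fin_num => //.
exact: bounded_measurable_integrable.
Qed.

Lemma Rintegral_sum (I : Type) (s : seq I) (f : I -> T -> R) :
  (forall i, bounded_measurable (f i)) ->
  \int[mu]_x (\sum_(i <- s) f i x) = \sum_(i <- s) \int[mu]_x f i x.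
Proof.
move=> bf; apply: EFin_inj; rewrite -EFin_Rintegral; last first.
  exact: bounded_measurable_sum.
under eq_integral do rewrite -sumEFin.
rewrite integral_sum//; last by move=> i; exact: bounded_measurable_integrable.
by rewrite -sumEFin; apply: eq_bigr => i _; rewrite EFin_Rintegral.
Qed.

Lemma bounded_RintegralZl (f : T -> R) (a : R) : bounded_measurable f ->
  \int[mu]_x (a * f x) = a * \int[mu]_x f x.
Proof.
by move=> bf; rewrite RintegralZl//; exact: bounded_measurable_integrable.
Qed.

Lemma Rintegral_cst1 (a : R) : \int[mu]_x a = a.
Proof. by rewrite Rintegral_cst// mu1 mulr1. Qed.

(** Both integrals can be restricted to [A], since its complement is negligible. This is how facts
    that hold only on the sphere, or only when a sample point lies in its cell, enter the
    integrals. *)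
Lemma le_Rintegral_on (A : set T) (f g : T -> R) :
  measurable A -> mu (~` A) = 0%E ->
  bounded_measurable f -> bounded_measurable g ->
  (forall x, A x -> f x <= g x) -> \int[mu]_x f x <= \int[mu]_x g x.
Proof.
move=> mA A0 bf bg fg; have mAC := measurableC mA.
have [fi gi] :=
  (bounded_measurable_integrable bf, bounded_measurable_integrable bg).
rewrite /Rintegral (negligible_integral mAC measurableT fi A0).
rewrite (negligible_integral mAC measurableT gi A0).
rewrite setDE setTI setCK; apply: le_Rintegral => //.
- exact: integrableS fi.
- exact: integrableS gi.
Qed.

Lemma eq_Rintegral_on (A : set T) (f g : T -> R) :
  measurable A -> mu (~` A) = 0%E ->
  bounded_measurable f -> bounded_measurable g ->
  (forall x, A x -> f x = g x) -> \int[mu]_x f x = \int[mu]_x g x.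
Proof.
move=> mA A0 bf bg fg; apply/eqP; rewrite eq_le; apply/andP; split.
  by apply: (le_Rintegral_on mA) => // x /fg ->.
by apply: (le_Rintegral_on mA) => // x /fg ->.
Qed.

End bounded_integrals.

(** * Factorization of expectations under independence *)

(** By independence the joint law of [X] and [Y] agrees with the product of the two laws on
    rectangles, hence everywhere by uniqueness of the product measure; Fubini then factors the
    integral. *)
Lemma Rintegral_indep (dO d1 d2 : measure_display) (Omega : measurableType dO)
    (T1 : measurableType d1) (T2 : measurableType d2) (R : realType)
    (P : probability Omega R) (X : {mfun Omega >-> T1})
    (Y : {mfun Omega >-> T2}) (f : T1 -> R) (g : T2 -> R) :
  (forall A B, measurable A -> measurable B ->
    P ((X @^-1` A) `&` (Y @^-1` B)) = (P (X @^-1` A) * P (Y @^-1` B))%E) ->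
  bounded_measurable f -> bounded_measurable g ->
  \int[P]_w (f (X w) * g (Y w)) = \int[P]_w f (X w) * \int[P]_w g (Y w).
Proof.
move=> indep bf bg.
have P1 : P setT = 1%E by exact: probability_setT.
have mXY : measurable_fun setT (fun w => (X w, Y w)).
  exact: measurable_fun_pair.
pose XY : {mfun Omega >-> (T1 * T2)%type} :=
  HB.pack (fun w => (X w, Y w)) (isMeasurableFun.Build _ _ _ _ _ mXY).
pose m1 : probability T1 R := distribution P X.
pose m2 : probability T2 R := distribution P Y.
pose h (z : T1 * T2) := f z.1 * g z.2.
have bh : bounded_measurable h.
  by apply: bounded_measurableM; apply: bounded_measurable_comp.
have prod_law A : measurable A -> (m1 \x m2)%E A = distribution P XY A.
  move: A.
  have unique := @product_measure_unique _ _ _ _ _ m1 m2 (distribution P XY).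
  by apply: unique => B C mB mC; exact: indep.
have prod1 : (m1 \x m2)%E setT = 1%E by rewrite prod_law// probability_setT.
have push (d' : measure_display) (T' : measurableType d')
    (Z : {mfun Omega >-> T'}) (k : T' -> R) : bounded_measurable k ->
    (\int[distribution P Z]_y (k y)%:E)%E = (\int[P]_w k (Z w))%:E.
  move=> bk; have bkZ : bounded_measurable (fun w => k (Z w)).
    exact: bounded_measurable_comp.
  rewrite integral_distribution//; last 2 first.
  - by apply/measurable_EFinP; case: bk.
  - exact: bounded_measurable_integrable.
  by rewrite EFin_Rintegral.
apply: EFin_inj; rewrite -(push _ _ XY h)//.
rewrite (eq_measure_integral (m1 \x m2)%E); last first.
  by move=> A mA _; exact/esym/prod_law.
rewrite -integral12_prod_meas1; last exact: bounded_measurable_integrable.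
have m11 := probability_setT m1; have m21 := probability_setT m2.
rewrite EFinM -(push _ _ X f)// -(push _ _ Y g)// -/m1 -/m2 /fubini_F /=.
rewrite (EFin_Rintegral m21)// -integralZr//; last first.
  exact: bounded_measurable_integrable.
apply: eq_integral => x _; under eq_integral do rewrite /h /= EFinM.
rewrite integralZl//; last exact: bounded_measurable_integrable.
by rewrite (EFin_Rintegral m21).
Qed.

(** * Linear maps, inner products and coordinates on the sphere *)

Lemma continuous_mx (T : topologicalType) (R : realType) (m n : nat)
    (f : T -> 'M[R]_(m, n)) :
  (forall i j, continuous (fun x => f x i j)) -> continuous f.
Proof.
(* A neighbourhood of a matrix contains a product of neighbourhoods [B i j] of its entries, so only
   finitely many conditions have to hold near [x]. *)
move=> cf x A [B nB BA]; rewrite /nbhs /=.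
suff : \forall y \near x, forall i j, B i j (f y i j).
  by apply: filterS => y; exact: BA.
apply: filter_forall => i; apply: filter_forall => j.
exact: (cf i j x _ (nB i j)).
Qed.

Section sphere_coordinates.
Context {R : realType} {d : nat}.
Implicit Types x y : 'rV[R]_d.+1.

Lemma measurable_coord k :
  measurable_fun setT (fun x : Rvec R d => (x : 'rV[R]_d.+1) ord0 k).
Proof.
apply: (measurability _ (RGenOpens.measurableE R)).
move=> _ [_ [a [b ->] <-]]; rewrite setTI; apply: sub_sigma_algebra.
by apply: open_comp; [move=> x _; exact: coord_continuous|exact: interval_open].
Qed.

Lemma continuous_mulmxr (Q : 'M[R]_d.+1) :
  continuous (fun x : 'rV[R]_d.+1 => x *m Q).
Proof.
apply: continuous_mx => i j.
have -> : (fun x : 'rV[R]_d.+1 => (x *m Q) i j) =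
    (fun x => \sum_k x i k * Q k j) by apply/funext => x; rewrite mxE.
move=> x; apply: (@cvg_big R _ _ _ _ (@add_continuous R) _ (nbhs x)) => k _.
by apply: cvgMl; exact: coord_continuous.
Qed.

Lemma measurable_mulmxr (Q : 'M[R]_d.+1) :
  measurable_fun setT
    (fun x : Rvec R d => ((x : 'rV[R]_d.+1) *m Q : Rvec R d)).
Proof.
apply: (@measurability _ _ (Rvec R d) (Rvec R d) setT
  (fun x => (x : 'rV[R]_d.+1) *m Q) _ erefl).
move=> _ [A oA <-]; rewrite setTI; apply: sub_sigma_algebra.
by apply: open_comp => // x _; exact: continuous_mulmxr.
Qed.

Lemma dotvC x y : dotv x y = dotv y x.
Proof. by apply: eq_bigr => k _; rewrite mulrC. Qed.

Lemma dotvDl x y z : dotv (x + y) z = dotv x z + dotv y z.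
Proof.
by rewrite -big_split; apply: eq_bigr => k _; rewrite mxE mulrDl.
Qed.

Lemma dotvNl x y : dotv (- x) y = - dotv x y.
Proof.
by rewrite /dotv (big_morph _ (@opprD _) (@oppr0 _)); apply: eq_bigr => k _;
  rewrite mxE mulNr.
Qed.

Lemma dotv_ge0 x : 0 <= dotv x x.
Proof. by apply: sumr_ge0 => k _; rewrite -expr2 sqr_ge0. Qed.

Lemma sphereE (x : Rvec R d) :
  sphere x <-> dotv (x : 'rV[R]_d.+1) (x : 'rV[R]_d.+1) = 1.
Proof.
rewrite /sphere /enorm /=; split => [nx|->]; last by rewrite sqrtr1.
by rewrite -(sqr_sqrtr (dotv_ge0 x)) nx expr1n.
Qed.

Lemma dotv_orthogonal (Q : 'M[R]_d.+1) x y :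
  orthogonal_mx Q -> dotv (x *m Q) (y *m Q) = dotv x y.
Proof.
have dotvE (u v : 'rV[R]_d.+1) : dotv u v = (u *m v^T) ord0 ord0.
  by rewrite mxE; apply: eq_bigr => k _; rewrite mxE.
by move=> oQ; rewrite !dotvE trmx_mul mulmxA -(mulmxA x) oQ mulmx1.
Qed.

Lemma measurable_sphere : measurable (@sphere R d).
Proof.
have -> : @sphere R d =
    (fun x : Rvec R d => dotv (x : 'rV[R]_d.+1) (x : 'rV[R]_d.+1)) @^-1` [set 1].
  by apply/seteqP; split => x /sphereE.
rewrite -[X in measurable X]setTI; have mdot : measurable_fun setT
    (fun x : Rvec R d => dotv (x : 'rV[R]_d.+1) (x : 'rV[R]_d.+1)).
  apply: measurable_sum => k.
  by apply: measurable_funM; exact: measurable_coord.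
exact: mdot.
Qed.

(* Restricting the coordinates to the sphere makes them bounded everywhere,
   at the price of equalities that only hold almost surely. *)
Definition sphere_coord (k : 'I_d.+1) (x : Rvec R d) : R :=
  (x : 'rV[R]_d.+1) ord0 k * \1_(@sphere R d) x.

Lemma sphere_coordE k (x : Rvec R d) :
  sphere x -> sphere_coord k x = (x : 'rV[R]_d.+1) ord0 k.
Proof. by move=> Sx; rewrite /sphere_coord indicE mem_set// mulr1. Qed.

Lemma sphere_coord_bounded k : bounded_measurable (sphere_coord k).
Proof.
split.
  apply: measurable_funM; first exact: measurable_coord.
  by apply: measurable_indic; exact: measurable_sphere.
exists 1 => x; have [Sx|nSx] := pselect (sphere x); last first.
  by rewrite /sphere_coord indicE memNset// mulr0 normr0.
rewrite sphere_coordE// -sqrtr_sqr -[leRHS]sqrtr1 ler_wsqrtr//.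
move/sphereE : Sx => <-; rewrite /dotv (bigD1 k)//= -expr2 lerDl.
by apply: sumr_ge0 => j _; rewrite -expr2 sqr_ge0.
Qed.

(** An orthogonal map preserves the sphere, so the indicator at the image point is the indicator at
    [x]. *)
Lemma sphere_coord_mulmx k (x : Rvec R d) (Q : 'M[R]_d.+1) :
  orthogonal_mx Q ->
  sphere_coord k ((x : 'rV[R]_d.+1) *m Q : Rvec R d) =
  ((x : 'rV[R]_d.+1) *m Q) ord0 k * \1_(@sphere R d) x.
Proof.
move=> oQ; rewrite /sphere_coord; congr (_ * _); rewrite !indicE.
congr (_%:R); congr nat_of_bool; apply/idP/idP; rewrite !inE => /sphereE Sx;
  by apply/sphereE; move: Sx; rewrite dotv_orthogonal.
Qed.

End sphere_coordinates.

(** * Second moments of the surface measure *)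

Section surface_measure_moments.
Context {R : realType} {d : nat}.
Variable sigma : {measure set (Rvec R d) -> \bar R}.
Hypothesis surface : normalized_surface_measure sigma.

Let sigma1 : sigma setT = 1%E. Proof. by case: surface. Qed.
Let sigmaS : sigma (~` @sphere R d) = 0%E. Proof. by case: surface. Qed.

(** Invariance says that the pushforward of [sigma] along right multiplication by [Q] is [sigma]
    itself; the rest is a change of variables. *)
Lemma Rintegral_mulmxr (Q : 'M[R]_d.+1) (f : Rvec R d -> R) :
  orthogonal_mx Q -> bounded_measurable f ->
  \int[sigma]_x f ((x : 'rV[R]_d.+1) *m Q : Rvec R d) = \int[sigma]_x f x.
Proof.
move=> oQ bf; have [_ _ invariant] := surface.
pose mulQ : {mfun Rvec R d >-> Rvec R d} :=
  HB.pack (fun x : Rvec R d => (x : 'rV[R]_d.+1) *m Q : Rvec R d)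
    (isMeasurableFun.Build _ _ _ _ _ (measurable_mulmxr Q)).
have bfQ : bounded_measurable (f \o mulQ).
  exact: bounded_measurable_comp.
congr fine; transitivity (\int[pushforward sigma mulQ]_x (f x)%:E)%E.
  rewrite [RHS]integral_pushforward//; last 2 first.
  - by apply/measurable_EFinP; case: bf.
  - exact: (bounded_measurable_integrable sigma1).
by apply: eq_measure_integral => A mA _; exact: invariant.
Qed.

(** The reflection that changes the sign of coordinate [k] alone. *)
Let flip_mx (k : 'I_d.+1) : 'M[R]_d.+1 :=
  diag_mx (\row_j (-1) ^+ (j == k)).

Let orthogonal_flip k : orthogonal_mx (flip_mx k).
Proof.
rewrite /orthogonal_mx tr_diag_mx mulmx_diag -diag_const_mx; congr diag_mx.
by apply/rowP => j; rewrite !mxE -expr2 sqrr_sign.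
Qed.

Let orthogonal_tperm k l : orthogonal_mx (tperm_mx k l : 'M[R]_d.+1).
Proof. by rewrite /orthogonal_mx tr_perm_mx -perm_mxM tpermV tperm2 perm_mx1. Qed.

Let second_moment k l := \int[sigma]_x (sphere_coord k x * sphere_coord l x).

Let bounded_product k l :
  bounded_measurable
    (fun x : Rvec R d => sphere_coord k x * sphere_coord l x : R).
Proof. by apply: bounded_measurableM; exact: sphere_coord_bounded. Qed.

(** Reflecting coordinate [k] changes the sign of the integrand, so the moment equals its own
    opposite. *)
Let second_moment_offdiag k l : k != l -> second_moment k l = 0.
Proof.
move=> kl; have : second_moment k l = -1 * second_moment k l.
  rewrite -(bounded_RintegralZl sigma1) //.
  rewrite -[LHS](Rintegral_mulmxr (orthogonal_flip k)) //.
  apply: eq_Rintegral => x _; rewrite !sphere_coord_mulmx// mul_mx_diag !mxE.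
  rewrite eqxx eq_sym (negbTE kl) expr0 expr1 mulr1 /sphere_coord; ring.
by lra.
Qed.

Let second_moment_diag k l : second_moment k k = second_moment l l.
Proof.
rewrite /second_moment -(Rintegral_mulmxr (orthogonal_tperm k l)) //.
have swap (x : 'rV[R]_d.+1) : (x *m tperm_mx k l) ord0 k = x ord0 l.
  by rewrite -xcolE mxE tpermL.
apply: eq_Rintegral => x _.
by rewrite !sphere_coord_mulmx// swap.
Qed.

(** The diagonal moments are all equal because transposing two coordinates preserves [sigma], and
    their sum is the integral of the squared norm, which is 1. *)
Lemma surface_second_moment k l :
  \int[sigma]_x (sphere_coord k x * sphere_coord l x) =
  (k == l)%:R / d.+1%:R.
Proof.
have [->|kl] := eqVneq k l; last by rewrite mul0r; exact: second_moment_offdiag.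
have : \sum_(j < d.+1) second_moment j j = 1.
  rewrite -(Rintegral_sum sigma1) // -[RHS](Rintegral_cst1 sigma1).
  apply: (eq_Rintegral_on sigma1 measurable_sphere sigmaS).
  - exact: bounded_measurable_sum.
  - exact: bounded_measurable_cst.
  move=> x Sx; move/sphereE : (Sx) => <-.
  by apply: eq_bigr => j _; rewrite sphere_coordE.
under eq_bigr do rewrite (second_moment_diag _ l).
rewrite sumr_const card_ord => trace1.
have d1_neq0 : d.+1%:R != 0 :> R by rewrite pnatr_eq0.
by apply: (mulIf d1_neq0); rewrite divfK// mulr_natr.
Qed.

End surface_measure_moments.

(** * The average law of the sample points *)

(** The laws of the points add up to the measure [n * sigma]. This is proved on measurable sets,
    then for nonnegative integrands, then for bounded ones by adding a constant. *)
Lemma sum_Rintegral_law (R : realType) (d n : nat) (hn : (0 < n)%N)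
    (sigma : {measure set (Rvec R d) -> \bar R}) (c : R)
    (D : 'I_n -> set (Rvec R d)) (dO : measure_display)
    (Omega : measurableType dO) (P : probability Omega R)
    (X : 'I_n -> Omega -> Rvec R d) (f : Rvec R d -> R) :
  normalized_surface_measure sigma ->
  equal_area_partition sigma c D ->
  jittered_sampling P sigma D X ->
  bounded_measurable f ->
  \sum_(i < n) \int[P]_w f (X i w) = n%:R * \int[sigma]_x f x.
Proof.
move=> [sigma1 sigmaS _] [mD coverD _ _ _] [mX _ lawX] bf.
have P1 : P setT = 1%E by exact: probability_setT.
pose i0 := Ordinal hn.
pose XM i : {mfun Omega >-> Rvec R d} :=
  HB.pack (X i) (isMeasurableFun.Build _ _ _ _ _ (mX i)).
(* [msum] is indexed by naturals, so the index is extended beyond ['I_n] with default [i0]; only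
   [k < n] enters the sum. *)
pose law k := distribution P (XM (insubd i0 k)).
pose total : {measure set (Rvec R d) -> \bar R} := msum law n.
have lawE A : measurable A ->
    total A = (\sum_(i < n) P (X i @^-1` A))%E.
  by move=> mA; apply: eq_bigr => i _; rewrite /law /= valKd.
have sub A : measurable A -> (n%:R%:E * sigma A <= total A)%E.
  move=> mA; rewrite lawE//.
  under eq_bigr do rewrite lawX//.
  rewrite -ge0_sume_distrr//; apply: lee_wpmul2l; first by rewrite lee_fin.
  have mS := @measurable_sphere R d.
  (* The cells cover only the sphere, so the part of [A] off the sphere, which is null, is dropped
     before subadditivity applies. *)
  have -> : sigma A = sigma (A `&` @sphere R d).
    rewrite -[in LHS](setUIDK A (@sphere R d)) measureU//; last 3 first.
    - exact: measurableI.
    - exact: measurableD.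
    - by rewrite setDE setIACA setICr setI0.
    rewrite [X in (_ + X)%E](_ : _ = 0%E) ?adde0//.
    apply/eqP; rewrite -measure_le0 -sigmaS le_measure ?inE//.
    - exact: measurableD.
    - exact: measurableC.
  pose F k := A `&` D (insubd i0 k).
  have -> : (\sum_(i < n) sigma (A `&` D i) = \sum_(i < n) sigma (F i))%E.
    by apply: eq_bigr => i _; rewrite /F valKd.
  apply: content_subadditive.
  - by move=> k _; exact: measurableI.
  - exact: measurableI.
  rewrite -bigcup_mkord -coverD => x [Ax [i _ Dix]].
  by exists (val i) => //=; rewrite /F valKd.
have lawT : total setT = n%:R%:E.
  rewrite lawE//; under eq_bigr do rewrite preimage_setT P1.
  by rewrite sumEFin sumr_const card_ord.
have fin_sigma A : measurable A -> sigma A \is a fin_num.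
  move=> mA; rewrite ge0_fin_numE//; apply: (@le_lt_trans _ _ 1%E); last first.
    exact: ltry.
  by rewrite -sigma1 le_measure ?inE.
have fin_law A : measurable A -> total A \is a fin_num.
  move=> mA; rewrite ge0_fin_numE//.
  apply: (@le_lt_trans _ _ n%:R%:E); last exact: ltry.
  by rewrite -lawT le_measure ?inE.
have compl (m : {measure set (Rvec R d) -> \bar R}) A : measurable A ->
    m A \is a fin_num -> m (~` A) \is a fin_num ->
    fine (m (~` A)) = fine (m setT) - fine (m A).
  move=> mA fA fAC; rewrite -(setUv A) measureU//.
  - by rewrite fineD// addrC addKr.
  - exact: measurableC.
  - exact: setICr.
(* Subadditivity bounds [n * sigma] by the total law on [A] and on [~` A];
   both have total mass [n], so the two bounds are equalities. *)
have law_eq A : measurable A -> total A = mscale n%:R%:nng sigma A.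
  move=> mA; have mAC := measurableC mA.
  have := sub _ mA; have := sub _ mAC.
  rewrite /mscale /= -(fineK (fin_sigma _ mA)) -(fineK (fin_sigma _ mAC)).
  rewrite -(fineK (fin_law _ mA)) -(fineK (fin_law _ mAC)) -!EFinM !lee_fin.
  rewrite (compl sigma)//; [|exact: fin_sigma..].
  rewrite (compl total)//; [|exact: fin_law..].
  rewrite sigma1 lawT /= => h1 h2; congr EFin; nra.
have law_ge0 g : bounded_measurable g -> (forall x, 0 <= g x) ->
    \sum_(i < n) \int[P]_w g (X i w) = n%:R * \int[sigma]_x g x.
  move=> bg g0; have mg : measurable_fun setT (EFin \o g).
    by apply/measurable_EFinP; case: bg.
  apply: EFin_inj; rewrite EFinM -(EFin_Rintegral sigma1)//.
  have g0' (x : Rvec R d) : setT x -> (0 <= (EFin \o g) x)%E.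
    by rewrite /= lee_fin.
  have /= <- := ge0_integral_mscale sigma measurableT n%:R%:nng mg g0'.
  rewrite -(@eq_measure_integral _ _ _ _ _ total); last first.
    by move=> A mA _; exact: law_eq.
  rewrite /total ge0_integral_measure_sum//.
  rewrite -sumEFin; apply: eq_bigr => i _.
  have bgX : bounded_measurable (fun w => g (X i w)).
    exact: bounded_measurable_comp.
  rewrite -(EFin_Rintegral P1)// /law valKd ge0_integral_distribution//.
have [_ [M fM]] := bf.
have bfM : bounded_measurable (fun x => f x + M).
  by apply: bounded_measurableD => //; exact: bounded_measurable_cst.
(* Adding the bound [M] makes the integrand nonnegative. It adds [M] to each of the [n] integrals on
   the left and [n * M] on the right, and these cancel. *)
have fM0 x : 0 <= f x + M by have := fM x; rewrite ler_norml; lra.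
have shift (d' : measure_display) (T : measurableType d')
    (mu : {measure set T -> \bar R}) (g : T -> R) : mu setT = 1%E ->
    bounded_measurable g -> \int[mu]_x (g x + M) = \int[mu]_x g x + M.
  move=> mu1 bg; rewrite RintegralD//.
  - by rewrite Rintegral_cst1.
  - exact: (bounded_measurable_integrable mu1).
  - apply: (bounded_measurable_integrable mu1).
    exact: bounded_measurable_cst.
have := law_ge0 _ bfM fM0; rewrite shift//.
under eq_bigr => i _.
  rewrite (shift _ _ P (fun w => f (X i w)))//; last first.
    exact: bounded_measurable_comp.
  over.
rewrite big_split /= sumr_const card_ord mulrDr (mulr_natl M n).
exact: (@addIr _ (M *+ n)).
Qed.

(** * Inner products of nearby unit vectors *)

(** For unit vectors the squared distance is [2 - 2 * dotv x y], whence
    [dotv x y >= 1 - r ^+ 2 / 2]. The right side is nonnegative as [r < Num.sqrt 2], so squaring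
    keeps the order. The squared norms of [x + y] and [x - y] being nonnegative puts [dotv x y]
    between -1 and 1. *)
Lemma sqr_dotv_bounds (R : realType) (d : nat) (x y : 'rV[R]_d.+1) (r : R) :
  dotv x x = 1 -> dotv y y = 1 -> r < Num.sqrt 2 -> enorm (x - y) <= r ->
  (1 - r ^+ 2 / 2) ^+ 2 <= dotv x y ^+ 2 <= 1.
Proof.
move=> xx yy r2 xyr.
have r0 : 0 <= r := le_trans (sqrtr_ge0 _) xyr.
have rr : r ^+ 2 <= 2.
  by rewrite -[leRHS]sqr_sqrtr// ler_sqr ?nnegrE ?sqrtr_ge0// ltW.
have expand (z : 'rV[R]_d.+1) :
    dotv (x + z) (x + z) = dotv x x + 2 * dotv x z + dotv z z.
  rewrite dotvDl !(dotvC _ (x + z)) !dotvDl (dotvC z x); ring.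
have lo : dotv (x - y) (x - y) <= r ^+ 2.
  by rewrite -(sqr_sqrtr (dotv_ge0 _)) ler_sqr ?nnegrE ?sqrtr_ge0.
have neg : dotv x (- y) = - dotv x y by rewrite dotvC dotvNl dotvC.
have negneg : dotv (- y) (- y) = 1 by rewrite dotvNl dotvC dotvNl yy opprK.
have := dotv_ge0 (x - y); have := dotv_ge0 (x + y); move: lo.
rewrite !expand neg negneg xx yy => lo hp hm.
by apply/andP; split; nra.
Qed.

(** * Expectation of the frame potential *)

Section frame_potential_expectation.
Context {R : realType} {d n : nat}.
Variables (hn : (0 < n)%N).
Variables (sigma : {measure set (Rvec R d) -> \bar R}) (c : R).
Variable D : 'I_n -> set (Rvec R d).
Context {dO : measure_display} {Omega : measurableType dO}.
Variables (P : probability Omega R) (X : 'I_n -> Omega -> Rvec R d).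
Hypothesis surface : normalized_surface_measure sigma.
Hypothesis partition : equal_area_partition sigma c D.
Hypothesis jittered : jittered_sampling P sigma D X.

Let P1 : P setT = 1%E. Proof. exact: probability_setT. Qed.
Let mX i : measurable_fun setT (X i). Proof. by case: jittered. Qed.
Let mD i : measurable (D i). Proof. by case: partition. Qed.

Let D_sphere i (x : Rvec R d) : D i x -> sphere x.
Proof. by case: partition => _ <- _ _ _ Dx; exists i. Qed.

Let mXD i : measurable (X i @^-1` D i).
Proof. by rewrite -[X in measurable X]setTI; exact: mX. Qed.

Let X_in_D i : P (~` (X i @^-1` D i)) = 0%E.
Proof.
have [_ _ law] := jittered.
rewrite preimage_setC law; last exact: measurableC (mD i).
by rewrite setICl measure0 mule0.
Qed.

(** On the sphere, the entries of the matrix [x^T *m x] for a row vector [x]; indexing by pairs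
    turns Frobenius products into single sums. *)
Let product_coord (kl : 'I_d.+1 * 'I_d.+1) (x : Rvec R d) : R :=
  sphere_coord kl.1 x * sphere_coord kl.2 x.

Let product_coord_bounded kl : bounded_measurable (product_coord kl).
Proof. by apply: bounded_measurableM; exact: sphere_coord_bounded. Qed.

Let product_coordX_bounded i kl :
  bounded_measurable (fun w => product_coord kl (X i w)).
Proof. exact: bounded_measurable_comp. Qed.

Let moment i kl := \int[P]_w product_coord kl (X i w).

(** The Frobenius product of the two rank-one matrices: on the sphere it is the squared inner
    product, and it separates into terms each a function of [x] times a function of [y]. *)
Let sqr_dot (x y : Rvec R d) : R :=
  \sum_kl product_coord kl x * product_coord kl y.

Let sqr_dotE (x y : Rvec R d) : sphere x -> sphere y ->
  sqr_dot x y = dotv (x : 'rV[R]_d.+1) (y : 'rV[R]_d.+1) ^+ 2.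
Proof.
move=> Sx Sy; rewrite /sqr_dot expr2 /dotv mulr_suml.
under [RHS]eq_bigr do rewrite mulr_sumr.
rewrite pair_big /=; apply: eq_bigr => -[k l] _.
rewrite /product_coord /= !sphere_coordE//; ring.
Qed.

Let sqr_dot_bounded i j :
  bounded_measurable (fun w => sqr_dot (X i w) (X j w)).
Proof.
by apply: bounded_measurable_sum => kl; exact: bounded_measurableM.
Qed.

Let moment_sum kl :
  \sum_(i < n) moment i kl = n%:R * ((kl.1 == kl.2)%:R / d.+1%:R).
Proof.
rewrite -(surface_second_moment surface).
exact: (sum_Rintegral_law hn surface partition jittered).
Qed.

Let independent_pair i j (A B : set (Rvec R d)) : i != j ->
  measurable A -> measurable B ->
  P ((X i @^-1` A) `&` (X j @^-1` B)) = (P (X i @^-1` A) * P (X j @^-1` B))%E.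
Proof.
move=> ij mA mB; have [_ indep _] := jittered.
(* Filling the other indices with [setT] reduces joint independence to the pair: those factors have
   probability 1. *)
pose E k := if k == i then A else if k == j then B else setT.
have mE k : measurable (E k) by rewrite /E; case: ifP => // _; case: ifP.
have Ei : E i = A by rewrite /E eqxx.
have Ej : E j = B by rewrite /E eq_sym (negbTE ij) eqxx.
have := indep E mE; rewrite (bigD1 i)//= (bigD1 j) 1?eq_sym//= Ei Ej.
rewrite big1 ?mule1 => [<-|k /andP[ki kj]]; last first.
  by rewrite /E (negbTE ki) (negbTE kj) preimage_setT.
congr (P _); apply/seteqP; split => w /=.
  by move=> [Aw Bw] k _; rewrite /E; case: eqP => [->//|_]; case: eqP => [->|].
by move=> h; split; [rewrite -Ei|rewrite -Ej]; exact: h.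
Qed.

Let mean_sqr_dot i j : i != j ->
  \int[P]_w sqr_dot (X i w) (X j w) = \sum_kl moment i kl * moment j kl.
Proof.
move=> ij; rewrite (Rintegral_sum P1); last first.
  by move=> kl; exact: bounded_measurableM.
apply: eq_bigr => kl _.
pose XM k : {mfun Omega >-> Rvec R d} :=
  HB.pack (X k) (isMeasurableFun.Build _ _ _ _ _ (mX k)).
apply: (@Rintegral_indep _ _ _ _ _ _ _ P (XM i) (XM j)) => // A B mA mB.
exact: independent_pair.
Qed.

Let mean_sqr_dot_diag i : \int[P]_w sqr_dot (X i w) (X i w) = 1.
Proof.
rewrite -[RHS](Rintegral_cst1 P1).
apply: (eq_Rintegral_on P1 (mXD i) (X_in_D i)) => //.
  exact: bounded_measurable_cst.
move=> w /D_sphere Sw; rewrite sqr_dotE//.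
by move/sphereE : Sw => ->; rewrite expr1n.
Qed.

Let radius := c / (n%:R `^ (d%:R^-1)).

Let sqr_dot_bounds i (x y : Rvec R d) : D i x -> D i y ->
  (1 - radius ^+ 2 / 2) ^+ 2 <= sqr_dot x y <= 1.
Proof.
move=> Dx Dy; have [_ _ _ _ [diamD radius2]] := partition.
rewrite sqr_dotE; [|exact: D_sphere Dx|exact: D_sphere Dy].
apply: sqr_dotv_bounds => //.
- by apply/sphereE; exact: D_sphere Dx.
- by apply/sphereE; exact: D_sphere Dy.
- exact: (diamD i).
Qed.

(* The squared Frobenius norm of [moment i] is the mean of [<x, y>^2] over
   two independent copies of [X i]; it is integrated one copy at a time. *)
Let moment_norm_bounds i :
  (1 - radius ^+ 2 / 2) ^+ 2 <= \sum_kl moment i kl ^+ 2 <= 1.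
Proof.
(* [H y] is the mean of [sqr_dot] with one copy frozen at [y]. *)
pose H (y : Rvec R d) : R := \sum_kl moment i kl * product_coord kl y.
have bscaled (a : R) kl :
    bounded_measurable (fun w => a * product_coord kl (X i w)).
  by apply: bounded_measurableM => //; exact: bounded_measurable_cst.
have bH : bounded_measurable (fun w => H (X i w)).
  by apply: bounded_measurable_sum.
have -> : \sum_kl moment i kl ^+ 2 = \int[P]_w H (X i w).
  rewrite (Rintegral_sum P1)//; apply: eq_bigr => kl _.
  by rewrite (bounded_RintegralZl P1)// expr2.
have HE y : H y = \int[P]_w sqr_dot y (X i w).
  rewrite (Rintegral_sum P1)//; apply: eq_bigr => kl _.
  by rewrite (bounded_RintegralZl P1)// mulrC.
have bdot y : bounded_measurable (fun w => sqr_dot y (X i w)).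
  exact: bounded_measurable_sum.
have bcst (a : R) : bounded_measurable (fun _ : Omega => a).
  exact: bounded_measurable_cst.
have Hbounds y : D i y -> (1 - radius ^+ 2 / 2) ^+ 2 <= H y <= 1.
  move=> Dy; rewrite HE; apply/andP; split.
    rewrite -[leLHS](Rintegral_cst1 P1).
    apply: (le_Rintegral_on P1 (mXD i) (X_in_D i)) => // w Dw.
    by have /andP[] := sqr_dot_bounds Dy Dw.
  rewrite -[leRHS](Rintegral_cst1 P1).
  apply: (le_Rintegral_on P1 (mXD i) (X_in_D i)) => // w Dw.
  by have /andP[] := sqr_dot_bounds Dy Dw.
apply/andP; split.
  rewrite -[leLHS](Rintegral_cst1 P1).
  apply: (le_Rintegral_on P1 (mXD i) (X_in_D i)) => // w Dw.
  by have /andP[] := Hbounds _ Dw.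
rewrite -[leRHS](Rintegral_cst1 P1).
apply: (le_Rintegral_on P1 (mXD i) (X_in_D i)) => // w Dw.
by have /andP[] := Hbounds _ Dw.
Qed.

Let total_moment_norm :
  \sum_(i < n) \sum_(j < n) \sum_kl moment i kl * moment j kl =
  n%:R ^+ 2 / d.+1%:R.
Proof.
(* The double sum of Frobenius products is the squared norm of the summed moment matrix, whose only
   nonzero entries are the [d.+1] diagonal ones, each [n / d.+1]. *)
transitivity (\sum_kl (\sum_(i < n) moment i kl) ^+ 2).
  under eq_bigr do rewrite exchange_big /=.
  rewrite exchange_big /=; apply: eq_bigr => kl _.
  rewrite expr2 mulr_suml; apply: eq_bigr => i _.
  by rewrite mulr_sumr.
under eq_bigr do rewrite moment_sum.
rewrite -(pair_big xpredT xpredT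
  (fun k l : 'I_d.+1 => (n%:R * ((k == l)%:R / d.+1%:R)) ^+ 2)) /=.
under eq_bigr => k _.
  rewrite (bigD1 k)//= eqxx big1 => [|l lk]; last first.
    by rewrite eq_sym (negbTE lk) mul0r mulr0 expr0n.
  over.
rewrite sumr_const card_ord -[_ *+ d.+1]mulr_natr.
have d1_neq0 : d.+1%:R != 0 :> R by rewrite pnatr_eq0.
by move: d1_neq0; rewrite mulr1n; set a := d.+1%:R => a_neq0; field.
Qed.

Let mean_frame_potentialE :
  'E_P[fun w => frame_potential (fun i => (X i w : 'rV[R]_d.+1))]%E =
  (n%:R ^+ 2 / d.+1%:R + n%:R
    - \sum_(i < n) \sum_kl moment i kl ^+ 2)%:E.
Proof.
pose F w := \sum_(i < n) \sum_(j < n) sqr_dot (X i w) (X j w).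
have bF : bounded_measurable F.
  by apply: bounded_measurable_sum => i; exact: bounded_measurable_sum.
have mFP : measurable_fun setT
    (fun w => frame_potential (fun i => (X i w : 'rV[R]_d.+1))).
  apply: measurable_sum => i; apply: measurable_sum => j.
  apply: measurable_funX; apply: measurableT_comp => //.
  apply: measurable_sum => k; apply: measurable_funM;
    exact: (measurableT_comp (measurable_coord k) (mX _)).
(* Almost surely every point lies in its cell, hence on the sphere, where [sqr_dot] is the squared
   inner product. *)
rewrite unlock (@ae_eq_integral _ _ _ P setT (EFin \o F))//; last 3 first.
- exact/measurable_EFinP.
- by apply/measurable_EFinP; case: bF.
- have good i : \forall w \near almost_everywhere P, D i (X i w).
    exists (~` (X i @^-1` D i)); split => //.
    exact: measurableC (mXD i).
  have : \forall w \near almost_everywhere P, forall i, D i (X i w).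
    exact: filter_forall.
  apply: filterS => w Dw _ /=; congr EFin.
  apply: eq_bigr => i _; apply: eq_bigr => j _.
  rewrite real_normK ?num_real// sqr_dotE//; exact: D_sphere (Dw _).
rewrite (EFin_Rintegral P1)//; congr EFin.
rewrite (Rintegral_sum P1); last by move=> i; exact: bounded_measurable_sum.
under eq_bigr do rewrite (Rintegral_sum P1)//.
rewrite -total_moment_norm.
(* Writing [n] as a sum of ones lets the identity be checked for each [i]: the diagonal term is 1
   instead of the squared norm of [moment i]. *)
have -> : n%:R = \sum_(i < n) (1 : R) by rewrite sumr_const card_ord.
rewrite -big_split -sumrB; apply: eq_bigr => i _ /=.
rewrite (bigD1 i)//= mean_sqr_dot_diag [in RHS](bigD1 i)//=.
under [X in _ + X]eq_bigr => j ji do rewrite mean_sqr_dot 1?eq_sym//.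
under [X in _ = X + _ + _ - _]eq_bigr do rewrite -expr2.
ring.
Qed.

(** The upper bound 1 on each squared moment norm gives the lower bound here, and the lower bound on
    it gives the upper one. *)
Lemma mean_frame_potential_bounds :
  ((n%:R ^+ 2 / d.+1%:R)%:E
     <= 'E_P[fun w => frame_potential (fun i => (X i w : 'rV[R]_d.+1))]
   /\ 'E_P[fun w => frame_potential (fun i => (X i w : 'rV[R]_d.+1))]
     <= (n%:R ^+ 2 / d.+1%:R + n%:R
         - n%:R * (1 - (c / (n%:R `^ (d%:R^-1))) ^+ 2 / 2) ^+ 2)%:E)%E.
Proof.
rewrite mean_frame_potentialE !lee_fin.
have cstE (a : R) : n%:R * a = \sum_(i < n) a.
  by rewrite sumr_const card_ord mulr_natl.
have up : \sum_(i < n) \sum_kl moment i kl ^+ 2 <= n%:R.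
  rewrite -[leRHS]mulr1 cstE; apply: ler_sum => i _.
  by have /andP[] := moment_norm_bounds i.
have lo : n%:R * (1 - radius ^+ 2 / 2) ^+ 2 <=
    \sum_(i < n) \sum_kl moment i kl ^+ 2.
  rewrite cstE; apply: ler_sum => i _.
  by have /andP[] := moment_norm_bounds i.
by rewrite -!addrA lerDl subr_ge0 up !lerD2l lerN2.
Qed.

End frame_potential_expectation.

Theorem theorem1 (R : realType) (d n : nat) (hd : (1 <= d)%N) (hn : (1 <= n)%N)
  (sigma : {measure set (Rvec R d) -> \bar R}) (c : R)
  (D : 'I_n -> set (Rvec R d))
  (dO : measure_display) (Omega : measurableType dO) (P : probability Omega R)
  (X : 'I_n -> Omega -> Rvec R d) :
  normalized_surface_measure sigma ->
  equal_area_partition sigma c D ->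
  jittered_sampling P sigma D X ->
  ((n%:R ^+ 2 / d.+1%:R)%:E
     <= 'E_P[fun w => frame_potential (fun i => (X i w : 'rV[R]_(d.+1)))]
   /\ 'E_P[fun w => frame_potential (fun i => (X i w : 'rV[R]_(d.+1)))]
     <= (n%:R ^+ 2 / d.+1%:R + n%:R
         - n%:R * (1 - c ^+ 2 / (2 * n%:R `^ (2 / d%:R))) ^+ 2)%:E)%E.
Proof.
move=> surface partition jittered.
(* The stated correction is half the squared diameter bound, since [n] to the power [2 / d] is the
   square of [n] to the power [1 / d]. *)
have -> : c ^+ 2 / (2 * n%:R `^ (2 / d%:R)) =
    (c / (n%:R `^ (d%:R^-1))) ^+ 2 / 2.
  rewrite (mulrC 2 d%:R^-1) powRrM powR_mulrn ?powR_ge0// expr_div_n.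
  by rewrite invfM mulrA mulrAC.
exact: (mean_frame_potential_bounds hn surface partition jittered).
Qed.
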